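(* For each $i\in\{1,2,3\}$, the principle $\mathsf{FC}$-$i$, viewed as a Weihrauch problem, is strongly Weihrauch equivalent to $\widehat{\mathsf{LPO}}$, and so is its infinite parallelization $\widehat{\mathsf{FC}\text{-}i}$.
   Context: A Weihrauch problem is a set $\mathsf{C}\subseteq 2^\omega\times 2^\omega$ of instance/solution pairs. $\mathsf{Q}\le_{\mathrm{sW}}\mathsf{R}$ means there are Turing functionals $\Phi,\Psi$ such that for every instance $A$ of $\mathsf{Q}$, $\Phi(A)$ is an instance of $\mathsf{R}$ and for every solution $T$ of $\Phi(A)$, $\Psi(T)$ is a solution of $A$; equivalence is reducibility both ways. The infinite parallelization $\widehat{\mathsf{Q}}$ has as instances sequences $\langle A_i\rangle$ of instances of $\mathsf{Q}$ and as solutions sequences $\langle B_i\rangle$ with $B_i$ a solution to $A_i$. $\mathsf{LPO}$: instance a function $p\colon\mathbb{N}\to\mathbb{N}$, solution the answer to whether some $n$ has $p(n)=0$; so $\widehat{\mathsf{LPO}}$ maps $\langle p_i\rangle$ to $\{i:\exists n\,p_i(n)=0\}$. Graphs are countable graphs $(V,E)$, $V\subseteq\mathbb{N}$ nonempty infinite; a component is a set of vertices any two joined by a finite path and closed under path connectedness; a set of vertices is totally disconnected if no two lie in the same component; the canonical index of $\{a_0<\cdots<a_k\}$ is $\prod_{i\le k}p_i^{a_i}$ with $p_i$ the $i$th prime. For each $\mathsf{FC}$-$i$ an instance is an infinite graph in which every component is finite, and a solution is: for $\mathsf{FC}$-1, a sequence $\langle d_1,d_2,\ldots\rangle$ of canonical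 indices of different components; for $\mathsf{FC}$-2, a family $\langle C_i:i\in\mathbb{N}\rangle$ of distinct components given as a function $C\colon\mathbb{N}^2\to\{0,1\}$; for $\mathsf{FC}$-3, an infinite totally disconnected set. *)

(* Defs.v *)
From mathcomp Require Import all_boot.
From mathcomp Require Import boolp classical_sets cardinality.
From Stdlib Require Cantor.

Set Implicit Arguments.
Unset Strict Implicit.
Unset Printing Implicit Defensive.

Local Open Scope classical_set_scope.

(** ** Coding in Cantor space *)

Definition cantor : Type := nat -> bool.

Definition npair (x y : nat) : nat := Cantor.to_nat (x, y).
Definition nfst (n : nat) : nat := (Cantor.of_nat n).1.
Definition nsnd (n : nat) : nat := (Cantor.of_nat n).2.

(* A sequence <A_0, A_1, ...> of points of Cantor space is coded by the set of
   all <i, n> with n in A_i. *)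
Definition section (A : cantor) (i : nat) : cantor := fun n => A (npair i n).

(* A function on the natural numbers is coded by its graph. *)
Definition codes_fun (A : cantor) (f : nat -> nat) : Prop :=
  forall n m, A (npair n m) = (f n == m).

(** ** Turing functionals *)

(* Partial recursive functions relative to an oracle, presented as unary
   functions on the natural numbers with pairing and projections as basic
   operations in place of functions of several variables. *)
Inductive prog : Type :=
| Zero
| Succ
| Fst
| Snd
| Oracle
| Pair of prog & prog
| Comp of prog & prog
| PrimRec of prog & prog
| Mu of prog.

(* [eval O c x y]: the program c with oracle O halts on input x with output y.
   In [eval_mu] the values r m of f below n witness that the search for the
   least zero does not diverge before n. *)
Inductive eval (O : cantor) : prog -> nat -> nat -> Prop :=
| eval_zero x : eval O Zero x 0
| eval_succ x : eval O Succ x x.+1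
| eval_fst x : eval O Fst x (nfst x)
| eval_snd x : eval O Snd x (nsnd x)
| eval_oracle x : eval O Oracle x (nat_of_bool (O x))
| eval_pair f g x a b :
    eval O f x a -> eval O g x b -> eval O (Pair f g) x (npair a b)
| eval_comp f g x a b :
    eval O g x a -> eval O f a b -> eval O (Comp f g) x b
| eval_rec0 f g x a :
    eval O f x a -> eval O (PrimRec f g) (npair x 0) a
| eval_recS f g x n a b :
    eval O (PrimRec f g) (npair x n) a ->
    eval O g (npair x (npair n a)) b ->
    eval O (PrimRec f g) (npair x n.+1) b
| eval_mu f x n (r : nat -> nat) :
    (forall m, m < n -> eval O f (npair x m) (r m).+1) ->
    eval O f (npair x n) 0 ->
    eval O (Mu f) x n.

(* The Turing functional with program c is defined on A with value B. *)
Definition computes (c : prog) (A B : cantor) : Prop :=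
  forall n, eval A c n (nat_of_bool (B n)).

(** ** Weihrauch problems *)

Definition problem : Type := cantor -> cantor -> Prop.

Definition instance (Q : problem) (A : cantor) : Prop := exists B, Q A B.

Definition sW_reducible (Q R : problem) : Prop :=
  exists Phi Psi : prog, forall A, instance Q A ->
    exists B, [/\ computes Phi A B, instance R B &
      forall T, R B T -> exists S, computes Psi T S /\ Q A S].

Definition sW_equiv (Q R : problem) : Prop :=
  sW_reducible Q R /\ sW_reducible R Q.

Definition parallelization (Q : problem) : problem :=
  fun A B => forall i, Q (section A i) (section B i).

(* The answer is represented by the point b000... of Cantor space, so that the
   solution of the parallelization is {<i, 0> : exists k, p_i k = 0}. *)
Definition LPO : problem := fun A B =>
  exists2 p : nat -> nat, codes_fun A p &
    forall n, B n = (n == 0) && `[< exists k, p k = 0 >].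

(** ** Graphs *)

(* A point of Cantor space is read as the join of a vertex set and a set of
   (ordered pairs representing) edges. *)
Definition vertices (A : cantor) : set nat := [set x | A x.*2].
Definition edge (A : cantor) : rel nat := fun x y => A (npair x y).*2.+1.

Definition infinite_graph (A : cantor) : Prop :=
  [/\ infinite_set (vertices A),
      forall x y, edge A x y -> vertices A x /\ vertices A y,
      symmetric (edge A) & irreflexive (edge A)].

Definition joined (A : cantor) (x y : nat) : Prop :=
  exists2 s : seq nat, path (edge A) x s & last x s = y.

Definition component (A : cantor) (C : set nat) : Prop :=
  [/\ C !=set0,
      C `<=` vertices A,
      forall x y, C x -> C y -> joined A x y &
      forall x y, C x -> joined A x y -> C y].

Definition totally_disconnected (A : cantor) (T : set nat) : Prop :=
  T `<=` vertices A /\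
  forall x y, T x -> T y -> x <> y ->
    ~ exists C, [/\ component A C, C x & C y].

Definition FC_instance (A : cantor) : Prop :=
  infinite_graph A /\ forall C, component A C -> finite_set C.

(** ** Canonical indices of finite sets *)

Lemma ex_prime_gt (m : nat) : exists p, prime p && (m < p).
Proof. by have [p lt_mp pr_p] := prime_above m; exists p; rewrite pr_p. Qed.

Fixpoint nth_prime (i : nat) : nat :=
  if i is j.+1 then ex_minn (ex_prime_gt (nth_prime j)) else 2.

Definition canonical_index (C : set nat) (d : nat) : Prop :=
  exists s : seq nat,
    [/\ s <> [::], sorted ltn s, C = [set` s] &
        d = \prod_(i < size s) nth_prime i ^ nth 0 s i].

(** ** The problems FC *)

Definition FC1 : problem := fun A B =>
  FC_instance A /\
  exists2 d : nat -> nat, codes_fun B d &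
    exists2 C : nat -> set nat, injective C &
      forall i, component A (C i) /\ canonical_index (C i) (d i).

Definition FC2 : problem := fun A B =>
  FC_instance A /\
  let C i : set nat := [set x | section B i x] in
  injective C /\ forall i, component A (C i).

Definition FC3 : problem := fun A B =>
  FC_instance A /\
  let T : set nat := [set x | B x] in
  infinite_set T /\ totally_disconnected A T.

(* Main.v *)
Require Import Defs.
From mathcomp Require Import all_boot.
From mathcomp Require Import boolp classical_sets cardinality.
From Stdlib Require Cantor.

Set Implicit Arguments.
Unset Strict Implicit.
Unset Printing Implicit Defensive.

Local Open Scope classical_set_scope.

(** Parallelization is monotone for [<=_sW], extensive and idempotent, so it is enough
    to show that each FC-i is equivalent to the parallelization of LPO.

    FC-i <= LPO^: LPO^ decides which vertices are joined, and which components reach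
    beyond a given bound. The least elements of the components form an infinite
    decidable set, and the components of its members can be computed together with
    their canonical indices.

    LPO^ <= FC-i: given p, say that i enters at stage y if y >= i is least such that
    p_i has a zero k <= y, and let low y be the least i which is y or enters at stage
    y. Each value of low is taken finitely often. The vertices are the stages s, each
    coded together with the set of those i that entered before s, and x < y are
    adjacent if low y <= low t for all t in [x, y). A stage after which low stays
    larger than its present value separates the earlier stages from the later ones, so
    the components are finite. Conversely, among any i + 2 pairwise unjoined stages
    there is one by which i has entered, if it ever does. So i + 2 vertices in
    different components, which every solution provides, decide whether p_i has a
    zero. *)

(** * Pairing and the least-number operator *)

Lemma nfstK x y : nfst (npair x y) = x.
Proof. by rewrite /nfst /npair Cantor.cancel_of_to. Qed.

Lemma nsndK x y : nsnd (npair x y) = y.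
Proof. by rewrite /nsnd /npair Cantor.cancel_of_to. Qed.

Lemma npair_surj z : npair (nfst z) (nsnd z) = z.
Proof. by rewrite /npair /nfst /nsnd -surjective_pairing Cantor.cancel_to_of. Qed.

Definition npairE := (nfstK, nsndK).

(** The default value 0 for an empty [P] makes this total, so it can occur in definitions before the
    search is known to succeed. *)
Definition least (P : pred nat) : nat :=
  if pselect (exists n, P n) is left h then ex_minn h else 0.

Lemma leastP (P : pred nat) : (exists n, P n) ->
  P (least P) /\ forall n, n < least P -> ~~ P n.
Proof.
rewrite /least => h; case: pselect => // h'; case: ex_minnP => m Pm mP.
by split=> // n; apply: contraTN => /mP; rewrite leqNgt.
Qed.

Lemma least_eq (P : pred nat) m : P m -> (forall n, P n -> m <= n) -> least P = m.
Proof.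
move=> Pm mP; have [Pl lP] : _ := @leastP P (ex_intro _ m Pm).
apply/eqP; rewrite eqn_leq mP // andbT leqNgt.
by apply/negP => /lP; rewrite Pm.
Qed.

(** * Functions computable relative to the oracles of a class *)

(** A single program serves all oracles of [D] and need only halt on those, so unbounded searches
    may rely on what is known of the oracle. *)
Definition rcomp (D : cantor -> Prop) (F : cantor -> nat -> nat) : Prop :=
  exists c, forall O, D O -> forall x, eval O c x (F O x).

Section Rcomp.
Variable D : cantor -> Prop.
Implicit Types (F G N : cantor -> nat -> nat) (P Q : cantor -> nat -> bool).
Notation rc := (rcomp D).

Lemma rcomp_ext F G : (forall O, D O -> F O =1 G O) -> rc F -> rc G.
Proof. by move=> FG [c cP]; exists c => O DO x; rewrite -FG //; apply: cP. Qed.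

Lemma rcomp_id : rc (fun O x => x).
Proof.
exists (Pair Fst Snd) => O _ x.
by rewrite -[X in eval _ _ _ X]npair_surj; do !constructor.
Qed.

Lemma rcomp_const k : rc (fun O x => k).
Proof.
elim: k => [|k [c cP]]; first by exists Zero => *; constructor.
by exists (Comp Succ c) => O DO x; apply: eval_comp (cP _ DO x) _; constructor.
Qed.

Lemma rcomp_succ F : rc F -> rc (fun O x => (F O x).+1).
Proof.
move=> [c cP]; exists (Comp Succ c) => O DO x.
by apply: eval_comp (cP O DO x) _; constructor.
Qed.

Lemma rcomp_fst F : rc F -> rc (fun O x => nfst (F O x)).
Proof.
move=> [c cP]; exists (Comp Fst c) => O DO x.
by apply: eval_comp (cP O DO x) _; constructor.
Qed.

Lemma rcomp_snd F : rc F -> rc (fun O x => nsnd (F O x)).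
Proof.
move=> [c cP]; exists (Comp Snd c) => O DO x.
by apply: eval_comp (cP O DO x) _; constructor.
Qed.

Lemma rcomp_oracle F : rc F -> rc (fun O x => nat_of_bool (O (F O x))).
Proof.
move=> [c cP]; exists (Comp Oracle c) => O DO x.
by apply: eval_comp (cP O DO x) _; constructor.
Qed.

Lemma rcomp_pair F G : rc F -> rc G -> rc (fun O x => npair (F O x) (G O x)).
Proof.
move=> [c cP] [d dP]; exists (Pair c d) => O DO x.
by apply: eval_pair; [apply: cP|apply: dP].
Qed.

Lemma rcomp_app F G : rc G -> rc F -> rc (fun O x => G O (F O x)).
Proof.
move=> [d dP] [c cP]; exists (Comp d c) => O DO x.
by apply: eval_comp (cP O DO x) _; apply: dP.
Qed.

Lemma rcomp_app2 (H : cantor -> nat -> nat -> nat) F G :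
  rc (fun O z => H O (nfst z) (nsnd z)) -> rc F -> rc G ->
  rc (fun O x => H O (F O x) (G O x)).
Proof.
move=> rH rF rG; have := rcomp_app rH (rcomp_pair rF rG).
by apply: rcomp_ext => O _ x; rewrite !npairE.
Qed.

(** [H] is any function obeying the recursion equations, so [iter], powers and finite sums are
    covered as they stand. *)
Lemma rcomp_rec (H : cantor -> nat -> nat -> nat)
    (S : cantor -> nat -> nat -> nat -> nat) F N :
  (forall O x, H O x 0 = F O x) ->
  (forall O x n, H O x n.+1 = S O x n (H O x n)) ->
  rc F -> rc (fun O z => S O (nfst z) (nfst (nsnd z)) (nsnd (nsnd z))) ->
  rc N -> rc (fun O x => H O x (N O x)).
Proof.
move=> H0 HS [c cP] [d dP] rN; apply: (rcomp_app2 _ rcomp_id rN).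
exists (PrimRec c d) => O DO z; rewrite -{1}[z]npair_surj.
elim: (nsnd z) => [|n IH]; first by rewrite H0; apply: eval_rec0; apply: cP.
apply: eval_recS IH _; rewrite HS.
by have := dP O DO (npair (nfst z) (npair n (H O (nfst z) n))); rewrite !npairE.
Qed.

Lemma rcomp_pred F : rc F -> rc (fun O x => (F O x).-1).
Proof.
by move=> rF; apply: (@rcomp_rec (fun _ _ n => n.-1) (fun _ _ n _ => n) (fun _ _ => 0));
 [| |apply: rcomp_const|apply/rcomp_fst/rcomp_snd/rcomp_id|].
Qed.

Lemma rcomp_add F G : rc F -> rc G -> rc (fun O x => F O x + G O x).
Proof.
move=> rF rG; apply: (@rcomp_rec (fun O x n => F O x + n) (fun _ _ _ a => a.+1) F) => //.
- by move=> *; rewrite addn0.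
- by move=> *; rewrite addnS.
by apply/rcomp_succ/rcomp_snd/rcomp_snd/rcomp_id.
Qed.

Lemma rcomp_sub F G : rc F -> rc G -> rc (fun O x => F O x - G O x).
Proof.
move=> rF rG; apply: (@rcomp_rec (fun O x n => F O x - n) (fun _ _ _ a => a.-1) F) => //.
- by move=> *; rewrite subn0.
- by move=> *; rewrite subnS.
by apply/rcomp_pred/rcomp_snd/rcomp_snd/rcomp_id.
Qed.

Lemma rcomp_mul F G : rc F -> rc G -> rc (fun O x => F O x * G O x).
Proof.
move=> rF rG; apply: (@rcomp_rec (fun O x n => F O x * n) (fun O x _ a => F O x + a)
   (fun _ _ => 0)) => //.
- by move=> *; rewrite muln0.
- by move=> *; rewrite mulnS.
- exact: rcomp_const.
apply: rcomp_add; last by apply/rcomp_snd/rcomp_snd/rcomp_id.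
exact: (rcomp_app rF (rcomp_fst rcomp_id)).
Qed.

Lemma rcomp_exp F G : rc F -> rc G -> rc (fun O x => F O x ^ G O x).
Proof.
move=> rF rG; apply: (@rcomp_rec (fun O x n => F O x ^ n) (fun O x _ a => F O x * a)
   (fun _ _ => 1)) => //.
- by move=> *; rewrite expnS.
- exact: rcomp_const.
apply: rcomp_mul; last by apply/rcomp_snd/rcomp_snd/rcomp_id.
exact: (rcomp_app rF (rcomp_fst rcomp_id)).
Qed.

Lemma rcomp_negb P : rc (fun O x => P O x) -> rc (fun O x => nat_of_bool (~~ P O x)).
Proof.
move=> rP; apply: rcomp_ext (rcomp_sub (rcomp_const 1) rP) => O _ x.
by case: (P O x).
Qed.

Lemma rcomp_and P Q : rc (fun O x => P O x) -> rc (fun O x => Q O x) ->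
  rc (fun O x => nat_of_bool (P O x && Q O x)).
Proof.
move=> rP rQ; apply: rcomp_ext (rcomp_mul rP rQ) => O _ x.
by case: (P O x) (Q O x) => -[].
Qed.

Lemma rcomp_or P Q : rc (fun O x => P O x) -> rc (fun O x => Q O x) ->
  rc (fun O x => nat_of_bool (P O x || Q O x)).
Proof.
move=> rP rQ; apply: rcomp_ext (rcomp_negb (rcomp_and (rcomp_negb rP) (rcomp_negb rQ))).
by move=> O _ x; rewrite negb_and !negbK.
Qed.

Lemma rcomp_implb P Q : rc (fun O x => P O x) -> rc (fun O x => Q O x) ->
  rc (fun O x => nat_of_bool (P O x ==> Q O x)).
Proof.
move=> rP rQ; apply: rcomp_ext (rcomp_or (rcomp_negb rP) rQ).
by move=> O _ x; rewrite implybE.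
Qed.

Lemma rcomp_eq0 F : rc F -> rc (fun O x => nat_of_bool (F O x == 0)).
Proof.
by move=> rF; apply: rcomp_ext (rcomp_sub (rcomp_const 1) rF) => O _ x; case: (F O x).
Qed.

Lemma rcomp_leq F G : rc F -> rc G -> rc (fun O x => nat_of_bool (F O x <= G O x)).
Proof. by move=> rF rG; apply: rcomp_eq0 (rcomp_sub rF rG). Qed.

Lemma rcomp_eq F G : rc F -> rc G -> rc (fun O x => nat_of_bool (F O x == G O x)).
Proof.
move=> rF rG; apply: rcomp_ext (rcomp_and (rcomp_leq rF rG) (rcomp_leq rG rF)).
by move=> O _ x; rewrite eqn_leq.
Qed.

Lemma rcomp_iter (H : cantor -> nat -> nat) F N :
  rc H -> rc F -> rc N -> rc (fun O x => iter (N O x) (H O) (F O x)).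
Proof.
move=> rH rF rN.
apply: (@rcomp_rec (fun O x n => iter n (H O) (F O x)) (fun O x _ a => H O a) F) => //.
by apply: (rcomp_app rH); apply/rcomp_snd/rcomp_snd/rcomp_id.
Qed.

Lemma rcomp_sum (T : cantor -> nat -> nat -> nat) N :
  rc (fun O z => T O (nfst z) (nsnd z)) -> rc N ->
  rc (fun O x => \sum_(i < N O x) T O x i).
Proof.
move=> rT rN; apply: (@rcomp_rec (fun O x n => \sum_(i < n) T O x i)
  (fun O x n a => a + T O x n) (fun _ _ => 0)) => //.
- by move=> *; rewrite big_ord0.
- by move=> *; rewrite big_ord_recr.
- exact: rcomp_const.
apply: rcomp_add; first by apply/rcomp_snd/rcomp_snd/rcomp_id.
apply: rcomp_app2 rT _ _; first exact/rcomp_fst/rcomp_id.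
exact/rcomp_fst/rcomp_snd/rcomp_id.
Qed.

Lemma rcomp_prod (T : cantor -> nat -> nat -> nat) N :
  rc (fun O z => T O (nfst z) (nsnd z)) -> rc N ->
  rc (fun O x => \prod_(i < N O x) T O x i).
Proof.
move=> rT rN; apply: (@rcomp_rec (fun O x n => \prod_(i < n) T O x i)
  (fun O x n a => a * T O x n) (fun _ _ => 1)) => //.
- by move=> *; rewrite big_ord0.
- by move=> *; rewrite big_ord_recr.
- exact: rcomp_const.
apply: rcomp_mul; first by apply/rcomp_snd/rcomp_snd/rcomp_id.
apply: rcomp_app2 rT _ _; first exact/rcomp_fst/rcomp_id.
exact/rcomp_fst/rcomp_snd/rcomp_id.
Qed.

Lemma rcomp_all (P : cantor -> nat -> nat -> bool) N :
  rc (fun O z => P O (nfst z) (nsnd z)) -> rc N ->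
  rc (fun O x => nat_of_bool (all (P O x) (iota 0 (N O x)))).
Proof.
move=> rP rN; apply: rcomp_ext (@rcomp_prod (fun O x i => P O x i) N rP rN) => O _ x.
elim: (N O x) => [|n IH]; first by rewrite big_ord0.
rewrite big_ord_recr IH -[in RHS]addn1 iotaD all_cat /= andbT add0n.
by case: all (P O x n) => -[].
Qed.

Lemma rcomp_has (P : cantor -> nat -> nat -> bool) N :
  rc (fun O z => P O (nfst z) (nsnd z)) -> rc N ->
  rc (fun O x => nat_of_bool (has (P O x) (iota 0 (N O x)))).
Proof.
move=> rP rN.
apply: rcomp_ext (rcomp_negb (@rcomp_all (fun O x i => ~~ P O x i) N (rcomp_negb rP) rN)).
move=> O _ x; rewrite -has_predC; congr nat_of_bool.
by apply: eq_has => i /=; rewrite negbK.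
Qed.

Lemma rcomp_least (P : cantor -> nat -> nat -> bool) :
  (forall O, D O -> forall x, exists n, P O x n) ->
  rc (fun O z => P O (nfst z) (nsnd z)) -> rc (fun O x => least (P O x)).
Proof.
move=> exP /rcomp_negb[c cP]; exists (Mu c) => O DO x.
have [Pl lP] := leastP (exP O DO x).
(* [Mu] looks for a zero of the negation of [P], which has value 1, the successor of 0, below the
   least solution. *)
apply: (@eval_mu _ _ _ _ (fun=> 0)) => [m /lP Pm|].
  by have := cP O DO (npair x m); rewrite !npairE Pm.
by have := cP O DO (npair x (least (P O x))); rewrite !npairE Pl.
Qed.

End Rcomp.

(** A hook for [rcomp_step], redefined once more functions are known to be computable. *)
Ltac rcomp_user := fail.

Ltac rcomp_step :=
  first [ assumption
  | match goal with
    | H : rcomp ?D (fun O x => nat_of_bool (?T O x))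
      |- rcomp ?D (fun O x => nat_of_bool (?T O (@?f O x))) => apply: (@rcomp_app D f _ H)
    end
  | exact: rcomp_id | exact: rcomp_const | rcomp_user |
  lazymatch goal with
  | |- rcomp _ (fun O x => nat_of_bool (@?p O x && @?q O x)) => apply: (@rcomp_and _ p q)
  | |- rcomp _ (fun O x => nat_of_bool (@?p O x || @?q O x)) => apply: (@rcomp_or _ p q)
  | |- rcomp _ (fun O x => nat_of_bool (@?p O x ==> @?q O x)) => apply: (@rcomp_implb _ p q)
  | |- rcomp _ (fun O x => nat_of_bool (~~ @?p O x)) => apply: (@rcomp_negb _ p)
  | |- rcomp _ (fun O x => nat_of_bool (@?f O x <= @?g O x)) => apply: (@rcomp_leq _ f g)
  | |- rcomp _ (fun O x => nat_of_bool (@?f O x == @?g O x)) => apply: (@rcomp_eq _ f g)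
  | |- rcomp _ (fun O x => nat_of_bool (all (@?p O x) (iota 0 (@?n O x)))) =>
      apply: (@rcomp_all _ p n)
  | |- rcomp _ (fun O x => nat_of_bool (has (@?p O x) (iota 0 (@?n O x)))) =>
      apply: (@rcomp_has _ p n)
  | |- rcomp _ (fun O x => nat_of_bool (O (@?f O x))) => apply: (@rcomp_oracle _ f)
  | |- rcomp _ (fun O x => nfst (@?f O x)) => apply: (@rcomp_fst _ f)
  | |- rcomp _ (fun O x => nsnd (@?f O x)) => apply: (@rcomp_snd _ f)
  | |- rcomp _ (fun O x => npair (@?f O x) (@?g O x)) => apply: (@rcomp_pair _ f g)
  | |- rcomp _ (fun O x => (@?f O x) + (@?g O x)) => apply: (@rcomp_add _ f g)
  | |- rcomp _ (fun O x => (@?f O x) - (@?g O x)) => apply: (@rcomp_sub _ f g)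
  | |- rcomp _ (fun O x => (@?f O x) * (@?g O x)) => apply: (@rcomp_mul _ f g)
  | |- rcomp _ (fun O x => (@?f O x) ^ (@?g O x)) => apply: (@rcomp_exp _ f g)
  | |- rcomp _ (fun O x => S (@?f O x)) => apply: (@rcomp_succ _ f)
  end ].
Ltac rcomp_tac := repeat (rcomp_step; cbn beta).

(** * Coded finite sequences and enumerations of infinite sets *)

Definition elt (c j : nat) : nat := nfst (iter j nsnd c).

(** Codes are nested pairs without a length: every number codes an infinite sequence, of which any
    finite initial segment can be prescribed. *)
Lemma elt_seq (s : seq nat) : exists c, forall j, j < size s -> elt c j = nth 0 s j.
Proof.
elim: s => [|a s [c cP]]; first by exists 0.
exists (npair a c) => -[|j] lt_js; rewrite /elt ?iterSr npairE //=.
exact: cP.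
Qed.

Lemma elt_fun (f : nat -> nat) n : exists c, forall j, j < n -> elt c j = f j.
Proof.
have [c cP] := elt_seq (mkseq f n); exists c => j lt_jn.
by rewrite cP ?size_mkseq // nth_mkseq.
Qed.

(** For infinite [T] this is the increasing enumeration. *)
Fixpoint enum_set (T : pred nat) (n : nat) : nat :=
  if n is m.+1 then least (fun x => (enum_set T m < x) && T x) else least T.

Lemma infinite_pred (T : pred nat) : infinite_set [set x | T x] ->
  forall a, exists x, (a < x) && T x.
Proof.
move=> infT a; apply: contrapT => noT; apply: infT.
apply: sub_finite_set (finite_II a.+1) => x /= Tx.
by rewrite ltnS leqNgt; apply/negP => lt_ax; apply: noT; exists x; rewrite lt_ax.
Qed.

Section EnumSet.
Variables (T : pred nat) (infT : infinite_set [set x | T x]).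

Lemma enum_setP n : T (enum_set T n).
Proof.
case: n => [|n] /=.
  have [|//] := @leastP T; have [x /andP[_ Tx]] := infinite_pred infT 0.
  by exists x.
by have [/andP[]] := leastP (infinite_pred infT (enum_set T n)).
Qed.

Lemma enum_set_ltS n : enum_set T n < enum_set T n.+1.
Proof. by have [/andP[]] := leastP (infinite_pred infT (enum_set T n)). Qed.

Lemma enum_set_inj : injective (enum_set T).
Proof.
apply: incn_inj; apply: leq_mono; apply: homo_ltn; first exact: ltn_trans.
exact: enum_set_ltS.
Qed.

End EnumSet.

(** * Computability of enumerations, halving, divisibility and primes *)

Section Rcomp2.
Variable D : cantor -> Prop.
Notation rc := (rcomp D).

Lemma rcomp_elt F G : rc F -> rc G -> rc (fun O x => elt (F O x) (G O x)).
Proof.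
move=> rF rG; apply: rcomp_fst.
by apply: (@rcomp_iter _ (fun _ y => nsnd y)) => //; rcomp_tac.
Qed.

Lemma rcomp_enum_set (T : cantor -> nat -> bool) N :
  (forall O, D O -> infinite_set [set x | T O x]) ->
  rc (fun O x => T O x) -> rc N -> rc (fun O x => enum_set (T O) (N O x)).
Proof.
move=> infT rT rN.
apply: (@rcomp_rec _ (fun O x n => enum_set (T O) n)
  (fun O x n a => least (fun y => (a < y) && T O y)) (fun O _ => least (T O))) => //.
  apply: (@rcomp_least _ (fun O _ y => T O y)) => [O DO _|].
    by have [x /andP[_ Tx]] := infinite_pred (infT O DO) 0; exists x.
  by rcomp_tac.
apply: (@rcomp_least _ (fun O z y => (nsnd (nsnd z) < y) && T O y)) => [O DO z|].
  exact: (infinite_pred (infT O DO) (nsnd (nsnd z))).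
by rcomp_tac.
Qed.

Lemma rcomp_double F : rc F -> rc (fun O x => (F O x).*2).
Proof. by move=> rF; apply: rcomp_ext (rcomp_add rF rF) => O _ x; rewrite addnn. Qed.

Lemma rcomp_half F : rc F -> rc (fun O x => (F O x)./2).
Proof.
move=> rF.
(* [x./2] is the least [n] with [x <= n.*2.+1]. *)
suff rh : rc (fun _ x => least (fun n => x <= n.*2.+1)).
  apply: rcomp_ext (rcomp_app rh rF) => O _ x; apply: least_eq.
    by rewrite -{1}[F O x]odd_double_half -add1n leq_add2r; case: odd.
  by move=> n /half_leq; rewrite /= uphalf_double.
apply: (@rcomp_least _ (fun _ x n => x <= n.*2.+1)) => [O _ x|].
  by exists x; rewrite -addnn -addnS leq_addr.
by rcomp_tac; apply: rcomp_double; rcomp_tac.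
Qed.

Lemma rcomp_odd F : rc F -> rc (fun O x => nat_of_bool (odd (F O x))).
Proof.
move=> rF; apply: rcomp_ext (rcomp_sub rF (rcomp_double (rcomp_half rF))) => O _ x.
by rewrite -{1}[F O x]odd_double_half addnK.
Qed.

Lemma rcomp_dvdn F G : rc F -> rc G -> rc (fun O x => nat_of_bool (F O x %| G O x)).
Proof.
move=> rF rG; apply: (@rcomp_app2 _ (fun _ x y => x %| y) _ _ _ rF rG).
have: rc (fun O z => has (fun q => nsnd z == q * nfst z) (iota 0 (nsnd z).+1)).
  by rcomp_tac.
apply: rcomp_ext => O _ z; congr nat_of_bool; apply/hasP/dvdnP => [[q _ /eqP]|[q def]].
  by exists q.
(* For dividend 0 the given quotient may lie outside the search range, and 0 serves instead;
   otherwise it is at most the dividend. *)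
have [def0|] := posnP (nsnd z).
  by exists 0 => //; rewrite def0.
rewrite def => gt0; exists q; rewrite // mem_iota /= ltnS leq_pmulr //.
by move: gt0; rewrite muln_gt0 => /andP[].
Qed.

Lemma rcomp_prime F : rc F -> rc (fun O x => nat_of_bool (prime (F O x))).
Proof.
move=> rF.
suff: rc (fun _ x => prime x) by move=> rp; apply: (rcomp_app rp rF).
have: rc (fun O x => (1 < x) && all (fun d => (d %| x) ==> (d <= 1)) (iota 0 x)).
  by rcomp_tac; apply: rcomp_dvdn; rcomp_tac.
apply: rcomp_ext => O _ x; congr nat_of_bool.
apply/andP/primeP => -[gt1 xP]; split => //.
  move=> d dx; have : d <= x by apply: dvdn_leq => //; apply: ltnW.
  rewrite leq_eqVlt => /orP[/eqP->|ltd]; first by rewrite eqxx orbT.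
  have := allP xP d; rewrite mem_iota ltd dx => /(_ isT) /=.
  by case: d dx {ltd} => [|[|d]] //; rewrite dvd0n => /eqP x0; rewrite x0 in gt1.
apply/allP => d; rewrite mem_iota /= add0n => ltd; apply/implyP => /xP.
by case/orP => /eqP dE; rewrite dE // ltnn in ltd *.
Qed.

Lemma rcomp_nth_prime F : rc F -> rc (fun O x => nth_prime (F O x)).
Proof.
move=> rF.
apply: (@rcomp_rec _ (fun _ _ n => nth_prime n)
  (fun _ _ _ a => least (fun p => prime p && (a < p))) (fun _ _ => 2)) => //.
- move=> O x n; rewrite [LHS]/=; case: ex_minnP => p pP minp.
  by rewrite (@least_eq _ p).
- by rcomp_tac.
apply: (@rcomp_least _ (fun _ z p => prime p && (nsnd (nsnd z) < p))).
  by move=> *; exact: ex_prime_gt.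
by rcomp_tac; apply: rcomp_prime; rcomp_tac.
Qed.

End Rcomp2.

Ltac rcomp_user ::= first
  [ apply: rcomp_elt | apply: rcomp_double | apply: rcomp_half | apply: rcomp_odd
  | apply: rcomp_dvdn | apply: rcomp_nth_prime ].

(** * Strong Weihrauch reducibility and parallelization *)

(** Each oracle query is answered by running [d], which yields the program of a composite
    functional. *)
Fixpoint subst_oracle (d c : prog) : prog :=
  match c with
  | Oracle => d
  | Pair f g => Pair (subst_oracle d f) (subst_oracle d g)
  | Comp f g => Comp (subst_oracle d f) (subst_oracle d g)
  | PrimRec f g => PrimRec (subst_oracle d f) (subst_oracle d g)
  | Mu f => Mu (subst_oracle d f)
  | _ => c
  end.

Lemma eval_subst_oracle d A B c x y :
  computes d A B -> eval B c x y -> eval A (subst_oracle d c) x y.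
Proof.
move=> dP; elim=> {c x y} /=; try by constructor.
- by move=> x; apply: dP.
- by move=> f g x a b _ ? _ ?; apply: eval_comp; eassumption.
- by move=> f g x n a b _ ? _ ?; apply: eval_recS; eassumption.
- by move=> f x n r _ IH _ ?; apply: eval_mu IH _.
Qed.

Lemma sW_trans Q R P : sW_reducible Q R -> sW_reducible R P -> sW_reducible Q P.
Proof.
move=> [c1 [d1 h1]] [c2 [d2 h2]].
exists (subst_oracle c1 c2), (subst_oracle d2 d1) => A /h1[B [cB /h2[C [cC iC h]] h']].
exists C; split=> // [n|T /h[S [dS /h'[U [dU QU]]]]].
  exact: eval_subst_oracle (cC n).
by exists U; split=> // n; apply: eval_subst_oracle (dU n).
Qed.

Definition reassoc : prog := Pair (Comp Fst Fst) (Pair (Comp Snd Fst) Snd).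

Lemma eval_reassoc O i x z : eval O reassoc (npair (npair i x) z) (npair i (npair x z)).
Proof.
have fstP u v : eval O Fst (npair u v) u by rewrite -{2}[u](nfstK u v); constructor.
have sndP u v : eval O Snd (npair u v) v by rewrite -{2}[v](nsndK u v); constructor.
apply: eval_pair; first by apply: eval_comp (fstP _ _) (fstP _ _).
by apply: eval_pair (sndP _ _); apply: eval_comp (fstP _ _) (sndP _ _).
Qed.

(** Turns a program for the oracle [section A i] into one for the oracle [A] and input [npair i x],
    uniformly in [i]. An oracle query at [x] becomes one at [npair i x], which is already the input.
    Recursion and search pair the input with a counter, and [reassoc] brings [i] back to the
    front. *)
Fixpoint on_section (c : prog) : prog :=
  match c with
  | Zero => Zero
  | Succ => Comp Succ Snd
  | Fst => Comp Fst Snd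
  | Snd => Comp Snd Snd
  | Oracle => Oracle
  | Pair f g => Pair (on_section f) (on_section g)
  | Comp f g => Comp (on_section f) (Pair Fst (on_section g))
  | PrimRec f g =>
      Comp (PrimRec (on_section f) (Comp (on_section g) reassoc))
           (Pair (Pair Fst (Comp Fst Snd)) (Comp Snd Snd))
  | Mu f => Mu (Comp (on_section f) reassoc)
  end.

Lemma eval_on_section A i c x y :
  eval (section A i) c x y -> eval A (on_section c) (npair i x) y.
Proof.
have fstP u v : eval A Fst (npair u v) u by rewrite -{2}[u](nfstK u v); constructor.
have sndP u v : eval A Snd (npair u v) v by rewrite -{2}[v](nsndK u v); constructor.
(* The recursor hidden in [on_section (PrimRec f g)] needs its own induction
   hypothesis. *)
pose recP c x y := if c is PrimRec f g then eval A
  (PrimRec (on_section f) (Comp (on_section g) reassoc))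
  (npair (npair i (nfst x)) (nsnd x)) y else True.
suff H : eval (section A i) c x y ->
   recP c x y /\ eval A (on_section c) (npair i x) y by move=> /H[].
(* The outer composition only rearranges the input, so evaluating the recursor is enough. *)
have split_rec f g z b : recP (PrimRec f g) z b ->
   recP (PrimRec f g) z b /\ eval A (on_section (PrimRec f g)) (npair i z) b.
  move=> h; split=> //=; apply: eval_comp h; apply: eval_pair.
    by apply: eval_pair => //; apply: eval_comp (sndP _ _) _; constructor.
  by apply: eval_comp (sndP _ _) _; constructor.
elim=> {c x y}.
- by move=> x; split=> //; constructor.
- by move=> x; split=> //; apply: eval_comp (sndP _ _) _; constructor.
- by move=> x; split=> //; apply: eval_comp (sndP _ _) _; constructor.
- by move=> x; split=> //; apply: eval_comp (sndP _ _) _; constructor.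
- by move=> x; split=> //; apply: (eval_oracle A (npair i x)).
- by move=> f g x a b _ [_ ?] _ [_ ?]; split=> //; apply: eval_pair.
- move=> f g x a b _ [_ ?] _ [_ ?]; split=> //.
  by apply: (@eval_comp _ _ _ _ (npair i a)) => //; apply: eval_pair.
- move=> f g x a _ [_ ?]; apply: split_rec; rewrite /recP !npairE.
  exact: eval_rec0.
- move=> f g x n a b _ [IH _] _ [_ ?]; apply: split_rec.
  move: IH; rewrite /recP !npairE => IH.
  by apply: eval_recS IH _; apply: eval_comp (eval_reassoc _ _ _ _) _.
- move=> f x n r _ IH _ [_ ?]; split=> //=.
  apply: (@eval_mu _ _ _ _ r) => [m /IH[_ h]|].
    exact: eval_comp (eval_reassoc _ _ _ _) h.
  by apply: eval_comp (eval_reassoc _ _ _ _) _.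
Qed.

Definition unsection (B : nat -> cantor) : cantor := fun z => B (nfst z) (nsnd z).

Lemma unsectionK B i : section (unsection B) i = B i.
Proof. by apply/funext => n; rewrite /section /unsection !npairE. Qed.

Lemma computes_on_section c A B :
  (forall i, computes c (section A i) (B i)) -> computes (on_section c) A (unsection B).
Proof.
by move=> h z; have := eval_on_section (h (nfst z) (nsnd z)); rewrite npair_surj.
Qed.

(** The programs given by [on_section] do not depend on [i]; choice only selects the intermediate
    instances and the solutions. *)
Lemma sW_parallelization Q R :
  sW_reducible Q R -> sW_reducible (parallelization Q) (parallelization R).
Proof.
move=> [c [d h]]; exists (on_section c), (on_section d) => A [B0 QB0].
have /choice[B BP] i : exists B, [/\ computes c (section A i) B, instance R B &
    forall T, R B T -> exists S, computes d T S /\ Q (section A i) S].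
  by apply: h; exists (section B0 i).
exists (unsection B); split.
- by apply: computes_on_section => i; have [] := BP i.
- have /choice[T RT] i : instance R (B i) by have [] := BP i.
  by exists (unsection T) => i; rewrite !unsectionK.
- move=> T RT; have /choice[S SP] i :
      exists S, computes d (section T i) S /\ Q (section A i) S.
    by have [_ _] := BP i; apply; rewrite -(unsectionK B).
  exists (unsection S); split; first by apply: computes_on_section => i; have [] := SP i.
  by move=> i; rewrite unsectionK; have [] := SP i.
Qed.

(** The oracles on which the backward functional is run; its searches have to halt just there. *)
Definition sol_image (Q R : problem) (Phi : cantor -> cantor) : cantor -> Prop :=
  fun T => exists A, instance Q A /\ R (Phi A) T.

Lemma sW_intro (Q R : problem) (Phi Psi : cantor -> cantor) :
  rcomp (instance Q) (fun O x => Phi O x) ->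
  rcomp (sol_image Q R Phi) (fun O x => Psi O x) ->
  (forall A, instance Q A -> instance R (Phi A)) ->
  (forall A T, instance Q A -> R (Phi A) T -> Q A (Psi T)) ->
  sW_reducible Q R.
Proof.
move=> [c cP] [d dP] iP sP; exists c, d => A iA; exists (Phi A); split.
- exact: cP.
- exact: iP.
- move=> T RT; exists (Psi T); split; last exact: sP.
  by apply: dP; exists A.
Qed.

(** The instance is repeated in a constant sequence, and the solution with index 0 is taken. *)
Lemma sW_le_parallelization Q : sW_reducible Q (parallelization Q).
Proof.
apply: (@sW_intro _ _ (fun A z => A (nsnd z)) (fun T n => T (npair 0 n))).
- by rcomp_tac.
- by rcomp_tac.
- move=> A [B QB]; exists (fun z => B (nsnd z)) => i.
  rewrite /section; under eq_fun do rewrite nsndK.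
  by under [X in Q _ X]eq_fun do rewrite nsndK.
- move=> A T _ /(_ 0); rewrite /section.
  by under [X in Q X _]eq_fun do rewrite nsndK.
Qed.

(** A double sequence is a sequence indexed by pairs; [assoc] and [unassoc] translate between the
    two codings. *)
Lemma sW_parallelization_idem Q :
  sW_reducible (parallelization (parallelization Q)) (parallelization Q).
Proof.
pose assoc z := npair (nfst (nfst z)) (npair (nsnd (nfst z)) (nsnd z)).
pose unassoc z := npair (npair (nfst z) (nfst (nsnd z))) (nsnd (nsnd z)).
have sectA A i j : section (section A i) j = section (fun z => A (assoc z)) (npair i j).
  by apply/funext => n; rewrite /section /assoc !npairE.
have sectU A i j : section (section (fun z => A (unassoc z)) i) j = section A (npair i j).
  by apply/funext => n; rewrite /section /unassoc !npairE.
apply: (@sW_intro _ _ (fun A z => A (assoc z)) (fun T z => T (unassoc z))).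
- by rewrite /assoc; rcomp_tac.
- by rewrite /unassoc; rcomp_tac.
- move=> A [B QB]; exists (fun z => B (assoc z)) => k.
  by rewrite -[k]npair_surj -!sectA; apply: QB.
- by move=> A T _ QT i j; rewrite sectA sectU; apply: QT.
Qed.

(** * Reducing FC to the parallelization of LPO *)

Lemma joined_refl A x : joined A x x.
Proof. by exists [::]. Qed.

Lemma joined_trans A y x z : joined A x y -> joined A y z -> joined A x z.
Proof.
move=> [s ps ls] [t pt lt]; exists (s ++ t); first by rewrite cat_path ps ls.
by rewrite last_cat ls.
Qed.

Lemma joined_edge A x y : edge A x y -> joined A x y.
Proof. by move=> e; exists [:: y] => //=; rewrite e. Qed.

Definition component_of (A : cantor) (x : nat) : set nat := [set y | joined A x y].

Section Graph.
Variables (A : cantor) (grA : infinite_graph A).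

Lemma joined_sym x y : joined A x y -> joined A y x.
Proof.
have [_ _ symA _] := grA; move=> [s]; elim: s x => [|a s IH] x /=.
  by move=> _ <-; exact: joined_refl.
move=> /andP[xa /IH{}IH] /IH h; apply: joined_trans h _.
by apply: joined_edge; rewrite symA.
Qed.

Lemma joined_vertices x y : vertices A x -> joined A x y -> vertices A y.
Proof.
have [_ eA _ _] := grA; move=> Vx [s]; elim: s x Vx => [|a s IH] x Vx /=.
  by move=> _ <-.
by move=> /andP[/eA[_ Va]]; apply: IH.
Qed.

Lemma component_ofP x : vertices A x -> component A (component_of A x).
Proof.
move=> Vx; split.
- by exists x; exact: joined_refl.
- by move=> y; apply: joined_vertices.
- by move=> y z /joined_sym xy xz; apply: joined_trans xz.
- by move=> y z xy yz; apply: joined_trans xy yz.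
Qed.

End Graph.

Lemma component_eq A C x : component A C -> C x -> C = component_of A x.
Proof.
move=> [_ _ jC cC] Cx; apply/seteqP; split=> y /=; first exact: jC.
exact: cC.
Qed.

(** The [i]th function vanishes at [k] exactly when [P O i k], so a solution decides all the
    statements [exists k, P O i k] at once. *)
Definition lpo_inst (P : cantor -> nat -> nat -> bool) (O : cantor) : cantor :=
  fun z => nat_of_bool (~~ P O (nfst z) (nfst (nsnd z))) == nsnd (nsnd z).

Lemma lpo_instP P O i :
  codes_fun (section (lpo_inst P O) i) (fun k => nat_of_bool (~~ P O i k)).
Proof. by move=> n m; rewrite /section /lpo_inst !npairE. Qed.

Lemma lpo_inst_instance P O : instance (parallelization LPO) (lpo_inst P O).
Proof.
exists (fun z => (nsnd z == 0) &&
  `[< exists k, nat_of_bool (~~ P O (nfst z) k) = 0 >]) => i.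
exists (fun k => nat_of_bool (~~ P O i k)); first exact: lpo_instP.
by move=> n; rewrite /section !npairE.
Qed.

Lemma lpo_inst_sol P O T : parallelization LPO (lpo_inst P O) T ->
  forall i, T (npair i 0) = `[< exists k, P O i k >].
Proof.
move=> h i; have [p pP /(_ 0)] := h i; rewrite /section eqxx /= => ->.
(* The solution only provides some function coded by the instance, and the code determines it. *)
have pE k : p k = nat_of_bool (~~ P O i k).
  by apply/eqP; rewrite -pP lpo_instP.
apply/asboolP/asboolP => -[k]; rewrite ?pE => Pk; exists k; move: Pk;
  by rewrite ?pE; case: (P O i k).
Qed.

Lemma rcomp_lpo_inst D (P : cantor -> nat -> nat -> bool) :
  rcomp D (fun O z => P O (nfst z) (nsnd z)) ->
  rcomp D (fun O z => lpo_inst P O z).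
Proof.
move=> rP; apply: rcomp_eq; last by rcomp_tac.
by apply: rcomp_negb; apply: (@rcomp_app2 _ (fun O i k => P O i k)); rcomp_tac.
Qed.

(* An instance <x, <y, up>> and a number <n, c>: the code c lists a path with n edges
   from x to some z >= y, where z = y if up = 0. *)
Definition reach (A : cantor) (i k : nat) : bool :=
  let x := nfst i in let y := nfst (nsnd i) in let up := nsnd (nsnd i) in
  let n := nfst k in let c := nsnd k in
  A x.*2 && (elt c 0 == x) &&
  (all (fun j => A (npair (elt c j) (elt c j.+1)).*2.+1) (iota 0 n)) &&
  (y <= elt c n) && (~~ (up == 0) || (elt c n <= y)).

Lemma rcomp_reach D : rcomp D (fun O z => reach O (nfst z) (nsnd z)).
Proof. by rewrite /reach; rcomp_tac. Qed.

Lemma reachP A x y u : (exists k, reach A (npair x (npair y u)) k) <->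
  vertices A x /\ exists z, [/\ joined A x z, y <= z & u = 0 -> z <= y].
Proof.
split=> [[k]|[Vx [z [[s ps ls] yz zy]]]].
  rewrite /reach !npairE => /andP[/andP[/andP[/andP[Vx /eqP c0] /allP ed] le1] le2].
  split=> //; exists (elt (nsnd k) (nfst k)); split=> // [|u0].
    2: by move: le2; rewrite u0.
  (* By induction on the number of edges, the first entry of the coded sequence is joined to the
     last. *)
  rewrite -{}c0; elim: (nfst k) ed => [|n IH] ed; first exact: joined_refl.
  apply: joined_trans (IH _) _.
    by move=> j; rewrite mem_iota add0n => lt_jn; apply: ed; rewrite mem_iota add0n leqW.
  by apply: joined_edge; apply: ed; rewrite mem_iota /= ltnS.
have [c cP] := elt_seq (x :: s).
exists (npair (size s) c); rewrite /reach !npairE.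
have -> : elt c 0 = x by rewrite cP.
have -> : elt c (size s) = z by rewrite cP //= -ls (last_nth 0).
rewrite Vx eqxx yz /= -andbA; apply/andP; split.
  apply/allP => j; rewrite mem_iota add0n => lt_js.
  by rewrite (cP _ (leqW lt_js)) (cP j.+1 lt_js); apply: (elimT (pathP 0) ps j).
by case: eqP => // /zy.
Qed.

(** The number of elements of [J] below an [x] in [J] is the position of [x] in the increasing list,
    which selects the right prime; for other [x] the exponent is 0. Canonical indices thus become
    bounded products. *)
Lemma canonical_product (J : pred nat) b (s := [seq x <- iota 0 b | J x]) :
  \prod_(x < b) nth_prime (\sum_(y < x) J y) ^ (x * J x) =
  \prod_(k < size s) nth_prime k ^ nth 0 s k.
Proof.
rewrite {}/s; pose s n := [seq x <- iota 0 n | J x].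
have sS n : s n.+1 = s n ++ nseq (J n) n.
  by rewrite /s -addn1 iotaD filter_cat /= add0n; case: (J n).
have sz n : \sum_(y < n) J y = size (s n).
  by elim: n => [|n IH]; rewrite ?big_ord0 // big_ord_recr sS size_cat size_nseq IH.
elim: b => [|b IH]; first by rewrite !big_ord0.
rewrite big_ord_recr IH -/(s b) -/(s b.+1) sS sz; case: (J b) => /=.
  rewrite size_cat addn1 big_ord_recr /= nth_cat ltnn subnn /= muln1; congr (_ * _).
  by apply: eq_bigr => k _; rewrite nth_cat ltn_ord.
by rewrite cats0 muln0 expn0 muln1.
Qed.

(** The inner 0 asks for [y] itself as endpoint, the outer one is the position of the answer of LPO.
    In particular [joins T x x] tests whether [x] is a vertex. *)
Definition joins (T : cantor) (x y : nat) : bool := T (npair (npair x (npair y 0)) 0).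

Definition joins_above (T : cantor) (x y : nat) : bool :=
  T (npair (npair x (npair y 1)) 0).

Definition is_min (T : cantor) (x : nat) : bool :=
  joins T x x && all (fun y => ~~ joins T x y) (iota 0 x).

Definition min_enum (T : cantor) (i : nat) : nat := enum_set (is_min T) i.

Definition min_component (T : cantor) (i : nat) : set nat :=
  [set y | joins T (min_enum T i) y].

(** For a finite component this is its largest element plus one. *)
Definition min_bound (T : cantor) (i : nat) : nat :=
  least (fun b => ~~ joins_above T (min_enum T i) b).

Definition min_index (T : cantor) (i : nat) : nat :=
  \prod_(x < min_bound T i)
    nth_prime (\sum_(y < x) joins T (min_enum T i) y) ^ (x * joins T (min_enum T i) x).

(** * Components and their minima from a solution of parallelized LPO *)

Section Solve.
Variables (A T : cantor).
Hypotheses (FA : FC_instance A) (AT : parallelization LPO (lpo_inst reach A) T).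

Let grA : infinite_graph A := FA.1.

Lemma joinsP x y : joins T x y <-> vertices A x /\ joined A x y.
Proof.
rewrite /joins (lpo_inst_sol AT); split=> [/asboolP/reachP[Vx [z [xz yz zy]]]|[Vx xy]].
  by split=> //; have /eqP <- : z == y by rewrite eqn_leq yz zy.
by apply/asboolP/reachP; split=> //; exists y.
Qed.

Lemma joins_aboveP x y : joins_above T x y <->
  vertices A x /\ exists z, joined A x z /\ y <= z.
Proof.
rewrite /joins_above (lpo_inst_sol AT); split=> [/asboolP/reachP[Vx [z [xz yz _]]]|].
  by split=> //; exists z.
by move=> [Vx [z [xz yz]]]; apply/asboolP/reachP; split=> //; exists z.
Qed.

Lemma is_minP x : is_min T x <->
  vertices A x /\ forall y, joined A x y -> x <= y.
Proof.
split=> [/andP[/joinsP[Vx _] /allP h]|[Vx h]].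
  split=> // y xy; rewrite leqNgt; apply/negP => lt_yx.
  have: y \in iota 0 x by rewrite mem_iota.
  by move=> /h/negP; apply; apply/joinsP.
apply/andP; split; first by apply/joinsP; split=> //; exact: joined_refl.
apply/allP => y; rewrite mem_iota /= add0n => lt_yx; apply/negP => /joinsP[_ /h].
by rewrite leqNgt lt_yx.
Qed.

(** Every vertex is joined to a minimum, so finitely many minima would make the vertex set a finite
    union of finite components. *)
Lemma infinite_is_min : infinite_set [set x | is_min T x].
Proof.
move=> finM; have [infV _ _ _] := grA; apply: infV.
apply: (@sub_finite_set _ _ (\bigcup_(x in [set x | is_min T x]) component_of A x)).
  move=> v Vv; pose m := least (joins T v).
  have [/joinsP[_ vm] mP] : joins T v m /\ forall n, n < m -> ~~ joins T v n.
    by apply: leastP; exists v; apply/joinsP; split=> //; exact: joined_refl.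
  exists m; last exact: joined_sym.
  apply/is_minP; split; first exact: joined_vertices vm.
  move=> y my; rewrite leqNgt; apply/negP => /mP/negP; apply.
  by apply/joinsP; split=> //; apply: joined_trans vm my.
apply: bigcup_finite => // x /is_minP[Vx _]; apply: FA.2; exact: component_ofP.
Qed.

Lemma min_enumP i : vertices A (min_enum T i) /\
  forall y, joined A (min_enum T i) y -> min_enum T i <= y.
Proof. by apply/is_minP; apply: enum_setP infinite_is_min i. Qed.

Lemma min_componentE i : min_component T i = component_of A (min_enum T i).
Proof.
have [V _] := min_enumP i.
by apply/seteqP; split=> y /= => [/joinsP[]|h] //; apply/joinsP.
Qed.

Lemma min_component_component i : component A (min_component T i).
Proof. by rewrite min_componentE; apply: component_ofP => //; have [] := min_enumP i. Qed.

Lemma min_component_inj : injective (min_component T).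
Proof.
move=> i j; rewrite !min_componentE => eqC; apply: (enum_set_inj infinite_is_min).
have ij : joined A (min_enum T i) (min_enum T j).
  rewrite -[joined _ _ _]/(component_of A (min_enum T i) (min_enum T j)) eqC.
  exact: joined_refl.
apply/eqP; rewrite eqn_leq (min_enumP i).2 // (min_enumP j).2 //; exact: joined_sym.
Qed.

Lemma ex_min_bound i : exists b, ~~ joins_above T (min_enum T i) b.
Proof.
have: finite_set (min_component T i) by apply: FA.2; apply: min_component_component.
move=> /finite_seqP[X XE]; exists (\max_(x <- X) x).+1.
apply/negP => /joins_aboveP[_ [z [jz]]].
have : min_component T i z by rewrite min_componentE.
rewrite XE /= => zX; rewrite ltnNge => /negP; apply.
by rewrite (big_rem z) //= leq_maxl.
Qed.

(** All elements lie below the bound, so filtering the numbers below it lists the whole component in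
    increasing order. *)
Lemma min_index_canonical i : canonical_index (min_component T i) (min_index T i).
Proof.
have [nb _] := leastP (ex_min_bound i); rewrite -/(min_bound T i) in nb.
have below y : joins T (min_enum T i) y -> y < min_bound T i.
  move=> /joinsP[V j]; rewrite ltnNge; apply/negP => le_by; case/negP: nb.
  by apply/joins_aboveP; split=> //; exists y.
exists [seq x <- iota 0 (min_bound T i) | joins T (min_enum T i) x]; split.
- have [[y jy] _ _ _] := min_component_component i.
  move=> s0; suff : y \in [::] by [].
  by rewrite -s0 mem_filter mem_iota /= add0n below // andbT.
- by apply: (sorted_filter ltn_trans); exact: iota_ltn_sorted.
- apply/seteqP; split=> y /=; rewrite mem_filter; last by case/andP.
  by move=> jy; apply/andP; split=> //; rewrite mem_iota add0n below.
- exact: canonical_product.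
Qed.

Lemma FC1_min_index : FC1 A (fun z => min_index T (nfst z) == nsnd z).
Proof.
split=> //; exists (min_index T); first by move=> n m; rewrite !npairE.
exists (min_component T); first exact: min_component_inj.
by move=> i; split; [exact: min_component_component|exact: min_index_canonical].
Qed.

Lemma FC2_min_component : FC2 A (fun z => joins T (min_enum T (nfst z)) (nsnd z)).
Proof.
have E i : [set x | section (fun z => joins T (min_enum T (nfst z)) (nsnd z)) i x] =
    min_component T i.
  by apply/seteqP; split=> x /=; rewrite /section !npairE.
split=> //=; split=> [i j|i]; rewrite !E; first exact: min_component_inj.
exact: min_component_component.
Qed.

(** Two minima in one component are each at most the other. *)
Lemma FC3_is_min : FC3 A (is_min T).
Proof.
split=> //; split; first exact: infinite_is_min.
split=> [x /is_minP[]//|x y /is_minP[_ hx] /is_minP[_ hy] xy [C [[_ _ jC _] Cx Cy]]].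
by apply: xy; apply/eqP; rewrite eqn_leq hx ?hy //; apply: jC.
Qed.

End Solve.

(** * Computability of these solutions *)

Section RcompSolve.
Variable D : cantor -> Prop.
Notation rc := (rcomp D).

Lemma rcomp_joins F G : rc F -> rc G -> rc (fun O x => joins O (F O x) (G O x)).
Proof. by move=> rF rG; rewrite /joins; rcomp_tac. Qed.

Lemma rcomp_is_min F : rc F -> rc (fun O x => is_min O (F O x)).
Proof.
move=> rF; suff h : rc (fun O x => is_min O x) by apply: (rcomp_app h rF).
by rewrite /is_min; rcomp_tac; apply: rcomp_joins; rcomp_tac.
Qed.

(** Ensures that the searches for the next minimum and for a bound halt. *)
Hypothesis DP : forall T, D T ->
  exists2 A, FC_instance A & parallelization LPO (lpo_inst reach A) T.

Lemma rcomp_min_enum F : rc F -> rc (fun O x => min_enum O (F O x)).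
Proof.
move=> rF; apply: (@rcomp_enum_set _ (fun O x => is_min O x)) => //.
  by move=> T /DP[A FA AT]; apply: infinite_is_min FA AT.
by apply: rcomp_is_min; rcomp_tac.
Qed.

Lemma rcomp_min_bound F : rc F -> rc (fun O x => min_bound O (F O x)).
Proof.
move=> rF; suff h : rc (fun O x => min_bound O x) by apply: (rcomp_app h rF).
apply: (@rcomp_least _ (fun O i b => ~~ joins_above O (min_enum O i) b)).
  by move=> T /DP[A FA AT]; apply: ex_min_bound FA AT.
by rewrite /joins_above; rcomp_tac; apply: rcomp_min_enum; rcomp_tac.
Qed.

Lemma rcomp_min_index F : rc F -> rc (fun O x => min_index O (F O x)).
Proof.
move=> rF; suff h : rc (fun O x => min_index O x) by apply: (rcomp_app h rF).
apply: (@rcomp_prod _ (fun O i x => nth_prime (\sum_(y < x) joins O (min_enum O i) y) ^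
  (x * joins O (min_enum O i) x))); last by apply: rcomp_min_bound; rcomp_tac.
have rj G H : rc G -> rc H -> rc (fun O x => joins O (min_enum O (G O x)) (H O x)).
  by move=> rG rH; apply: rcomp_joins => //; apply: rcomp_min_enum.
rcomp_tac; last by apply: rj; rcomp_tac.
apply: (@rcomp_sum _ (fun O z y => joins O (min_enum O (nfst z)) y)); last by rcomp_tac.
by apply: rj; rcomp_tac.
Qed.

End RcompSolve.

(** The second conclusion, solvability, serves the converse reduction, where the constructed graph
    has to be an instance of [Q]. *)
Lemma FC_le_LPO (Q : problem) (Psi : cantor -> cantor) :
  (forall A B, Q A B -> FC_instance A) ->
  (forall D, (forall T, D T ->
     exists2 A, FC_instance A & parallelization LPO (lpo_inst reach A) T) ->
     rcomp D (fun O x => Psi O x)) ->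
  (forall A T, FC_instance A -> parallelization LPO (lpo_inst reach A) T -> Q A (Psi T)) ->
  sW_reducible Q (parallelization LPO) /\ (forall A, FC_instance A -> instance Q A).
Proof.
move=> QF rP QP; split.
  apply: (@sW_intro _ _ (lpo_inst reach) Psi).
  - exact/rcomp_lpo_inst/rcomp_reach.
  - by apply: rP => T [A [[B /QF FA] AT]]; exists A.
  - by move=> A _; apply: lpo_inst_instance.
  - by move=> A T [B /QF FA] AT; apply: QP.
move=> A FA; have [T AT] := lpo_inst_instance reach A.
by exists (Psi T); apply: QP.
Qed.

Lemma FC1_le_LPO : sW_reducible FC1 (parallelization LPO) /\
  (forall A, FC_instance A -> instance FC1 A).
Proof.
apply: (@FC_le_LPO _ (fun T z => min_index T (nfst z) == nsnd z)).
- by move=> A B [].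
- by move=> D DP; rcomp_tac; apply: rcomp_min_index => //; rcomp_tac.
- exact: FC1_min_index.
Qed.

Lemma FC2_le_LPO : sW_reducible FC2 (parallelization LPO) /\
  (forall A, FC_instance A -> instance FC2 A).
Proof.
apply: (@FC_le_LPO _ (fun T z => joins T (min_enum T (nfst z)) (nsnd z))).
- by move=> A B [].
- by move=> D DP; apply: rcomp_joins; first apply: rcomp_min_enum => //; rcomp_tac.
- exact: FC2_min_component.
Qed.

Lemma FC3_le_LPO : sW_reducible FC3 (parallelization LPO) /\
  (forall A, FC_instance A -> instance FC3 A).
Proof.
apply: (@FC_le_LPO _ is_min).
- by move=> A B [].
- by move=> D _; apply: rcomp_is_min; rcomp_tac.
- exact: FC3_is_min.
Qed.

(** * Reducing the parallelization of LPO to FC *)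

(** Since [A] codes functions by their graphs, this bit says that the [i]th function vanishes at
    [k]. *)
Definition hit (A : cantor) (i k : nat) : bool := A (npair i (npair k 0)).

(** Index and zero are both bounded by the stage, so a stage has only finitely many bits to
    record. *)
Definition found (A : cantor) (i s : nat) : bool := (i < s) && has (hit A i) (iota 0 s).

Definition enters (A : cantor) (i y : nat) : bool := found A i y.+1 && ~~ found A i y.

Definition low (A : cantor) (y : nat) : nat :=
  least (fun i => (i == y) || enters A i y).

(** Many numbers code the same initial segment; taking the least gives each stage exactly one vertex
    and keeps the vertex set decidable. *)
Definition bits (A : cantor) (s : nat) : nat :=
  least (fun w => all (fun i => elt w i == nat_of_bool (found A i s)) (iota 0 s)).

Definition stage_vertex (A : cantor) (s : nat) : nat := npair s (bits A s).

Definition is_stage (A : cantor) (v : nat) : bool := nsnd v == bits A (nfst v).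

Definition link (A : cantor) (x y : nat) : bool :=
  (x < y) && all (fun t => (x <= t) ==> (low A y <= low A t)) (iota 0 y).

Definition stage_edge (A : cantor) (u v : nat) : bool :=
  is_stage A u && is_stage A v &&
  (link A (nfst u) (nfst v) || link A (nfst v) (nfst u)).

Definition stage_graph (A : cantor) : cantor := fun z =>
  (odd z && stage_edge A (nfst z./2) (nsnd z./2)) || (~~ odd z && is_stage A z./2).

Lemma vertices_stage_graph A v : vertices (stage_graph A) v = is_stage A v.
Proof. by rewrite /vertices /= /stage_graph odd_double doubleK. Qed.

Lemma edge_stage_graph A u v : edge (stage_graph A) u v = stage_edge A u v.
Proof.
by rewrite /edge /stage_graph /= odd_double uphalf_double !npairE orbF.
Qed.

Lemma found_mono A i s s' : s <= s' -> found A i s -> found A i s'.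
Proof.
move=> le_s /andP[lt_is /hasP[k]]; rewrite mem_iota /= => lt_ks hk.
rewrite /found (leq_trans lt_is le_s); apply/hasP; exists k => //.
by rewrite mem_iota /= (leq_trans lt_ks le_s).
Qed.

Lemma elt_bits A i s : i < s -> elt (bits A s) i = found A i s.
Proof.
move=> lt_is; have [w wP] := elt_fun (fun i => nat_of_bool (found A i s)) s.
have [|/allP h _] := @leastP (fun w =>
  all (fun i => elt w i == found A i s :> nat) (iota 0 s)).
  by exists w; apply/allP => j; rewrite mem_iota => /wP->.
by apply/eqP/h; rewrite mem_iota.
Qed.

Lemma lowP A y : (low A y == y) || enters A (low A y) y.
Proof.
have [|//] := @leastP (fun i => (i == y) || enters A i y).
by exists y; rewrite eqxx.
Qed.

Lemma low_le A i y : enters A i y -> low A y <= i.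
Proof.
move=> ent; have [|_ h] := @leastP (fun i => (i == y) || enters A i y).
  by exists i; rewrite ent orbT.
by rewrite leqNgt; apply/negP => /h; rewrite ent orbT.
Qed.

Lemma enters_inj A i y y' : enters A i y -> enters A i y' -> y = y'.
Proof.
move=> /andP[f nf] /andP[f' nf']; case: (ltngtP y y') => // lt.
  by have := found_mono lt f; rewrite (negPf nf').
by have := found_mono lt f'; rewrite (negPf nf).
Qed.

(** A value [m] can occur only at stage [m] and at the stage where [m] enters, if there is one. *)
Lemma low_unbounded A n : exists b, forall y, low A y <= n -> y <= b.
Proof.
have step m : exists b, forall y, low A y = m -> y <= b.
  have [[z ez]|nz] := pselect (exists z, enters A m z).
    exists (maxn m z) => y ly; have := lowP A y; rewrite ly => /orP[/eqP <-|ey].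
      exact: leq_maxl.
    by rewrite (enters_inj ey ez) leq_maxr.
  exists m => y ly; have := lowP A y; rewrite ly => /orP[/eqP <-//|ey].
  by case: nz; exists y.
elim: n => [|n [b bP]].
  by have [b bP] := step 0; exists b => y; rewrite leqn0 => /eqP; apply: bP.
have [b' b'P] := step n.+1; exists (maxn b b') => y; rewrite leq_eqVlt leq_max.
by move=> /orP[/eqP/b'P->|/bP->]; rewrite ?orbT.
Qed.

Lemma linkP A x y t : link A x y -> x <= t -> t < y -> low A y <= low A t.
Proof.
move=> /andP[_ /allP h] le_xt lt_ty; have := h t.
by rewrite mem_iota le_xt => /(_ lt_ty).
Qed.

Lemma is_stageE A v : is_stage A v -> v = stage_vertex A (nfst v).
Proof. by move=> /eqP vE; rewrite /stage_vertex -vE npair_surj. Qed.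

Lemma is_stage_vertex A s : is_stage A (stage_vertex A s).
Proof. by rewrite /is_stage /stage_vertex !npairE. Qed.

Lemma infinite_graph_stage A : infinite_graph (stage_graph A).
Proof.
split.
- move=> /(finite_image nfst) fin; apply: infinite_nat; move: fin.
  apply: sub_finite_set => s _; exists (stage_vertex A s); last exact: nfstK.
  by rewrite vertices_stage_graph is_stage_vertex.
- by move=> u v; rewrite edge_stage_graph !vertices_stage_graph => /andP[/andP[]].
- by move=> u v; rewrite !edge_stage_graph /stage_edge orbC [is_stage A v && _]andbC.
- by move=> u; rewrite edge_stage_graph /stage_edge orbb /link ltnn andbF.
Qed.

(* The last stage b at which [low] is at most [low x] cannot be jumped over by an
   edge: the right end y of such an edge would have low y <= low b. *)
Lemma joined_bounded A v :
  exists b, forall u, joined (stage_graph A) v u -> nfst u <= b.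
Proof.
have [B BP] := low_unbounded A (low A (nfst v)).
have exv : exists y, low A y <= low A (nfst v) by exists (nfst v).
have [b lb bP] := ex_maxnP exv BP.
have cut y : b < y -> low A b < low A y.
  move=> lt_by; rewrite (leq_ltn_trans lb) // ltnNge; apply/negP => /bP.
  by rewrite leqNgt lt_by.
exists b => u [s]; have := bP _ (leqnn _).
(* [b] was chosen from the first vertex; along the path only [cut] and the bound on the current
   stage are kept. *)
elim: s v {B BP exv lb bP} => [|a s IH] v le_vb /=; first by move=> _ <-.
rewrite edge_stage_graph => /andP[/andP[_ lk] ps]; apply: IH ps; rewrite leqNgt.
apply/negP => lt_ba; case/orP: lk => lk.
  by have := linkP lk le_vb lt_ba; rewrite leqNgt cut.
case/andP: lk => lt_av _; move: lt_av; rewrite ltnNge.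
by rewrite (leq_trans le_vb (ltnW lt_ba)).
Qed.

(** The stages of a component are bounded, and a stage determines its vertex. *)
Lemma FC_instance_stage_graph A : FC_instance (stage_graph A).
Proof.
split=> [|C cC]; first exact: infinite_graph_stage.
have [[v Cv] CV _ _] := cC; have [b bP] := joined_bounded A v.
apply: sub_finite_set (finite_image (stage_vertex A) (finite_II b.+1)) => u Cu.
exists (nfst u).
  by rewrite /= ltnS; apply: bP; move: Cu; rewrite (component_eq cC Cv).
by rewrite -is_stageE // -vertices_stage_graph; apply: CV.
Qed.

(** A single edge suffices, unless both stages are the same. *)
Lemma low_min_joined A x t : is_stage A x -> nfst x <= t ->
  (forall t', nfst x <= t' -> t' <= t -> low A t <= low A t') ->
  joined (stage_graph A) x (stage_vertex A t).
Proof.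
move=> sx le_xt h; have [<-|ne_xt] := eqVneq (nfst x) t.
  by rewrite -is_stageE //; exact: joined_refl.
apply: joined_edge; rewrite edge_stage_graph /stage_edge sx is_stage_vertex /=.
rewrite /link /stage_vertex npairE ltn_neqAle ne_xt le_xt; apply/orP; left=> /=.
apply/allP => t'; rewrite mem_iota add0n => lt_t't; apply/implyP => le_xt'.
by apply: h => //; apply: ltnW.
Qed.

(* Otherwise let i enter at stage y, after all the stages of e 0, ..., e (i+1). The
   minima of [low] over the intervals from these stages to y are at most [low y <= i],
   so two of them agree; the later one is attained at a stage adjacent to both. *)
Lemma found_unjoined A (e : nat -> nat) i :
  (forall j, is_stage A (e j)) ->
  (forall j k, joined (stage_graph A) (e j) (e k) -> j = k) ->
  (exists k, hit A i k) -> exists2 j, j < i.+2 & found A i (nfst (e j)).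
Proof.
move=> se uj [k hk]; apply: contrapT => nf.
have exs : exists s, found A i s.
  exists (maxn i k).+1; rewrite /found ltnS leq_maxl; apply/hasP; exists k => //.
  by rewrite mem_iota /= ltnS leq_maxr.
(* Nothing is found at stage 0, so the first stage at which [i] is found is a successor [y.+1], and
   [i] enters at [y]. *)
have [] := leastP exs; set m := least _; case: m => [|y] // fy my.
have ent : enters A i y by rewrite /enters fy my.
have le_ey j : j < i.+2 -> nfst (e j) <= y.
  move=> lt_j; rewrite leqNgt; apply/negP => lt_y; apply: nf; exists j => //.
  exact: found_mono fy.
pose P j n := has (fun t => (nfst (e j) <= t) && (low A t == n)) (iota 0 y.+1).
pose g j := least (P j).
have PI j t : nfst (e j) <= t -> t <= y -> P j (low A t).
  by move=> le1 le2; apply/hasP; exists t; rewrite ?mem_iota ?ltnS ?le1 ?eqxx.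
have gP j : j < i.+2 -> P j (g j) /\ forall n, P j n -> g j <= n.
  move=> lt_j; have [|Pg gm] := @leastP (P j).
    by exists (low A y); apply: PI => //; exact: le_ey.
  by split=> // n Pn; rewrite leqNgt; apply/negP => /gm; rewrite Pn.
have g_le j : j < i.+2 -> g j < i.+1.
  move=> lt_j; rewrite ltnS (leq_trans _ (low_le ent)) //; apply (gP j lt_j).2.
  by apply: PI => //; exact: le_ey.
have g_inj j l : j < i.+2 -> l < i.+2 -> nfst (e j) <= nfst (e l) -> g j = g l -> j = l.
  move=> lt_j lt_l le_jl gE; apply: uj.
  have [/hasP[t]] := (gP l lt_l).1.
  rewrite mem_iota /= add0n ltnS => le_ty /andP[le_lt /eqP lt].
  apply: (@joined_trans _ (stage_vertex A t)).
    apply: low_min_joined => // [|t' le1 le2]; first exact: leq_trans le_jl le_lt.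
    by rewrite lt -gE; apply: (gP j lt_j).2; apply: PI => //; exact: leq_trans le2 le_ty.
  apply: (joined_sym (infinite_graph_stage A)); apply: low_min_joined => // t' le1 le2.
  by rewrite lt; apply: (gP l lt_l).2; apply: PI => //; exact: leq_trans le2 le_ty.
(* Pigeonhole: there are [i.+2] indices but only [i.+1] possible minima. *)
pose f (j : 'I_i.+2) : 'I_i.+1 := Ordinal (g_le j (ltn_ord j)).
suff /leq_card : injective f by rewrite !card_ord ltnn.
move=> j l [gE]; apply: val_inj => /=.
by case: (leqP (nfst (e j)) (nfst (e l))) => [|/ltnW] le_jl; [|symmetry]; apply: g_inj.
Qed.

(** Both searches halt on every oracle: the stage itself is a candidate for [low], and every finite
    sequence has a code for [bits]. *)
Lemma rcomp_stage_graph D : rcomp D (fun A z => stage_graph A z).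
Proof.
have rF F G : rcomp D F -> rcomp D G -> rcomp D (fun A z => found A (F A z) (G A z)).
  move=> ? ?; apply: (@rcomp_app2 _ (fun A i s => found A i s)) => //.
  by rewrite /found /hit; rcomp_tac.
have rE F G : rcomp D F -> rcomp D G -> rcomp D (fun A z => enters A (F A z) (G A z)).
  by move=> ? ?; rewrite /enters; rcomp_tac; apply: rF; rcomp_tac.
have rlow F : rcomp D F -> rcomp D (fun A z => low A (F A z)).
  move=> r; suff h : rcomp D (fun A z => low A z) by apply: (rcomp_app h r).
  apply: (@rcomp_least _ (fun A y i => (i == y) || enters A i y)).
    by move=> A _ y; exists y; rewrite eqxx.
  by rcomp_tac; apply: rE; rcomp_tac.
have rbits F : rcomp D F -> rcomp D (fun A z => bits A (F A z)).
  move=> r; suff h : rcomp D (fun A z => bits A z) by apply: (rcomp_app h r).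
  apply: (@rcomp_least _ (fun A s w =>
    all (fun i => elt w i == nat_of_bool (found A i s)) (iota 0 s))).
    move=> A _ s; have [w wP] := elt_fun (fun i => nat_of_bool (found A i s)) s.
    by exists w; apply/allP => j; rewrite mem_iota => /wP->.
  by rcomp_tac; apply: rF; rcomp_tac.
have rS F : rcomp D F -> rcomp D (fun A z => is_stage A (F A z)).
  by move=> r; rewrite /is_stage; rcomp_tac; apply: rbits; rcomp_tac.
have rL F G : rcomp D F -> rcomp D G -> rcomp D (fun A z => link A (F A z) (G A z)).
  move=> ? ?; apply: (@rcomp_app2 _ (fun A x y => link A x y)) => //.
  by rewrite /link; rcomp_tac; apply: rlow; rcomp_tac.
rewrite /stage_graph /stage_edge; rcomp_tac.
all: first [apply: rS | apply: rL]; rcomp_tac.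
Qed.

(** The three principles differ only in the way [en] extracts pairwise unjoined vertices from a
    solution. *)
Lemma LPO_le_FC (Q : problem) (en : cantor -> nat -> nat) :
  (forall A, FC_instance A -> instance Q A) ->
  (forall A B, Q A B -> (forall j, vertices A (en B j)) /\
     forall j k, joined A (en B j) (en B k) -> j = k) ->
  (forall D, (forall T, D T -> exists A, Q A T) -> rcomp D en) ->
  sW_reducible (parallelization LPO) Q.
Proof.
move=> QI QP ren.
(* The vertices carry their stages and bits, so the answer is read from the solution alone, as
   strong reducibility demands. Only bits below the stage are meaningful, hence the guard. *)
pose Psi (T : cantor) z := (nsnd z == 0) &&
  has (fun j => (nfst z < nfst (en T j)) && (elt (nsnd (en T j)) (nfst z) == 1))
    (iota 0 (nfst z).+2).
apply: (@sW_intro _ _ stage_graph Psi).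
- exact: rcomp_stage_graph.
- have {}ren F : rcomp (sol_image (parallelization LPO) Q stage_graph) F ->
      rcomp (sol_image (parallelization LPO) Q stage_graph) (fun O x => en O (F O x)).
    by apply: rcomp_app; apply: ren => T [A [_ QT]]; exists (stage_graph A).
  by rewrite /Psi; rcomp_tac; apply: ren; rcomp_tac.
- by move=> A _; apply/QI/FC_instance_stage_graph.
move=> A T [B AB] /QP[ve uj] i; have [p pP _] := AB i; exists p => // n.
have hitE k : hit A i k = (p k == 0) by rewrite -pP.
have bitE j : (i < nfst (en T j)) && (elt (nsnd (en T j)) i == 1) =
    found A i (nfst (en T j)).
  have /eqP -> : is_stage A (en T j) by rewrite -vertices_stage_graph.
  have [lt_i|ge_i] := boolP (i < _); last by rewrite /found (negPf ge_i).
  by rewrite elt_bits //; case: found.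
rewrite /section /Psi !npairE; congr (_ && _).
apply/hasP/asboolP => [[j _]|[k pk]].
  by rewrite bitE => /andP[_ /hasP[k _]]; rewrite hitE => /eqP pk; exists k.
have [|||j lt_j fj] := @found_unjoined A (en T) i.
- by move=> j; rewrite -vertices_stage_graph.
- exact: uj.
- by exists k; rewrite hitE pk.
by exists j; rewrite ?mem_iota // bitE.
Qed.

(** * Extracting unjoined vertices from the solutions of each principle *)

Lemma components_unjoined A (C : nat -> set nat) (e : nat -> nat) :
  injective C -> (forall j, component A (C j)) -> (forall j, C j (e j)) ->
  (forall j, vertices A (e j)) /\ forall j k, joined A (e j) (e k) -> j = k.
Proof.
move=> injC cC Ce; split=> [j|j k jk].
  by have [_ CV _ _] := cC j; apply: CV.
apply: injC; rewrite (component_eq (cC k) (Ce k)); apply: component_eq => //.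
by have [_ _ _ clC] := cC j; apply: clC jk.
Qed.

Lemma prime_nth_prime i : prime (nth_prime i).
Proof. by case: i => [|i] //=; case: ex_minnP => p /andP[]. Qed.

Lemma nth_prime_gt2 i : 2 < nth_prime i.+1.
Proof.
rewrite /=; case: ex_minnP => p /andP[_ lt] _.
exact: leq_ltn_trans (prime_gt1 (prime_nth_prime i)) lt.
Qed.

(** The first prime is 2 and the others are odd, so the exponent of 2 in [d] is the first entry of
    the increasing list. *)
Lemma canonical_index_least C d : canonical_index C d ->
  (exists k, ~~ (2 ^ k.+1 %| d)) /\ C (least (fun k => ~~ (2 ^ k.+1 %| d))).
Proof.
move=> [[|a s] [] // _ _ -> ->] {d}; rewrite big_ord_recl.
set r := \prod_(i < _) _.
have odd_r : ~~ (2 %| r).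
  rewrite dvdn2 negbK /r; elim/big_ind: _ => // [m n om on|i _]; first by rewrite oddM om.
  rewrite lift0 oddX; have [p2|->] := even_prime (prime_nth_prime i.+1); last exact: orbT.
  by have := nth_prime_gt2 i; rewrite p2.
have na : ~~ (2 ^ a.+1 %| 2 ^ a * r) by rewrite expnSr dvdn_pmul2l // expn_gt0.
split; first by exists a.
rewrite (@least_eq _ a) /= ?inE ?eqxx // => k; apply: contraR; rewrite -ltnNge => lt_ka.
exact/dvdn_mulr/dvdn_exp2l.
Qed.

(** A search in the graph coded by the solution recovers [d j], whose exponent of 2 is a vertex of
    the [j]th component. *)
Lemma LPO_le_FC1 : sW_reducible (parallelization LPO) FC1.
Proof.
have dE A B : FC1 A B -> exists2 d : nat -> nat,
    forall j, least (fun m => B (npair j m)) = d j &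
    exists2 C : nat -> set nat, injective C &
      forall i, component A (C i) /\ canonical_index (C i) (d i).
  move=> [_ [d dP h]]; exists d => // j; apply: least_eq; first by rewrite dP.
  by move=> n; rewrite dP => /eqP->.
apply: (@LPO_le_FC _ (fun B j =>
  least (fun k => ~~ (2 ^ k.+1 %| least (fun m => B (npair j m)))))).
- exact: FC1_le_LPO.2.
- move=> A B /dE[d dP [C injC CP]]; apply: (components_unjoined injC) => j.
    by have [] := CP j.
  by rewrite dP; have [_ /canonical_index_least[]] := CP j.
- move=> D DP.
  apply: (@rcomp_least _ (fun B j k => ~~ (2 ^ k.+1 %| least (fun m => B (npair j m))))).
    move=> T /DP[A /dE[d dP [C _ CP]]] j; rewrite dP.
    by have [_ /canonical_index_least[]] := CP j.
  have h : rcomp D (fun B j => least (fun m => B (npair j m))).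
    apply: (@rcomp_least _ (fun B j m => B (npair j m))); last by rcomp_tac.
    move=> T /DP[A [_ [d dP _]]] j; exists (d j); by rewrite dP.
  by rcomp_tac; apply: (rcomp_app h); rcomp_tac.
Qed.

(** The least element of each component represents it; the search halts as components are
    nonempty. *)
Lemma LPO_le_FC2 : sW_reducible (parallelization LPO) FC2.
Proof.
have exC A B : FC2 A B -> forall j, exists x, B (npair j x).
  by move=> [_ [_ CP]] j; have [[x Cx] _ _ _] := CP j; exists x.
apply: (@LPO_le_FC _ (fun B j => least (fun x => B (npair j x)))).
- exact: FC2_le_LPO.2.
- move=> A B QB; have [_ [injC CP]] := QB; apply: (components_unjoined injC) => // j.
  by have [] := leastP (exC _ _ QB j).
- move=> D DP; apply: (@rcomp_least _ (fun B j x => B (npair j x))); last by rcomp_tac.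
  by move=> T /DP[A QT]; apply: exC QT.
Qed.

(** Distinct members of a totally disconnected set are unjoined, so its increasing enumeration can
    be used. *)
Lemma LPO_le_FC3 : sW_reducible (parallelization LPO) FC3.
Proof.
apply: (@LPO_le_FC _ enum_set).
- exact: FC3_le_LPO.2.
- move=> A B [[grA _] [infB [BV Bd]]]; have eB := enum_setP infB.
  split=> [j|j k jk]; first exact: (BV _ (eB j)).
  apply: (enum_set_inj infB); apply: contrapT => ne.
  apply: (Bd _ _ (eB j) (eB k) ne); exists (component_of A (enum_set B j)); split=> //.
    exact: (component_ofP grA (BV _ (eB j))).
  exact: joined_refl.
- move=> D DP; apply: (@rcomp_enum_set _ (fun O x => O x)); try by rcomp_tac.
  by move=> T /DP[A [_ []]].
Qed.

Theorem theorem6p5 (FC : problem) (hFC : [\/ FC = FC1, FC = FC2 | FC = FC3]) :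
  sW_equiv FC (parallelization LPO) /\
  sW_equiv (parallelization FC) (parallelization LPO).
Proof.
have [le ge] : sW_equiv FC (parallelization LPO).
  case: hFC => ->; split.
  - exact: FC1_le_LPO.1.
  - exact: LPO_le_FC1.
  - exact: FC2_le_LPO.1.
  - exact: LPO_le_FC2.
  - exact: FC3_le_LPO.1.
  - exact: LPO_le_FC3.
split=> //; split.
  exact: sW_trans (sW_parallelization le) (sW_parallelization_idem LPO).
exact: sW_trans ge (sW_le_parallelization FC).
Qed.
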